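(* Consider $VP_k$ as a subgroup of $VP_{k+1}$ by adding a trivial strand at the end (i.e. $\lambda_{ij}\mapsto\lambda_{ij}$). Then: (1) For $n\ge3$, the subgroup $T_{n-1}$ of $VP_n$ is generated by the elements $a_{k,l}$, $b_{k,l}$ with $k+l=n$ (and $k,l\ge 1$). (2) For $n\ge 2$, the group $VP_n=\langle T_1,T_2,\ldots,T_{n-1}\rangle$ is generated by $a_{k,l}$ and $b_{k,l}$ for $2\le k+l\le n$, $1\le k,l\le n-1$. (3) $VP_{n+1}=\langle VP_n,s_0VP_n,s_1VP_n,\ldots,s_{n-1}VP_n\rangle$ for $n\ge2$.
   Context: $VP_n$ is the virtual pure braid group: it has generators $\lambda_{ij}$, $1\le i\ne j\le n$, and defining relations $\lambda_{ij}\lambda_{kl}=\lambda_{kl}\lambda_{ij}$ and $\lambda_{ki}\lambda_{kj}\lambda_{ij}=\lambda_{ij}\lambda_{kj}\lambda_{ki}$, where distinct letters stand for distinct indices. For $0\le i\le n-1$, the degeneracy homomorphism $s_i:VP_n\to VP_{n+1}$ (doubling the $(i+1)$th strand) is given, for $1\le k<l\le n$, by: $s_i(\lambda_{k,l})=\lambda_{k+1,l+1}$ if $i<k-1$; $\lambda_{k,l+1}\lambda_{k+1,l+1}$ if $i=k-1$; $\lambda_{k,l+1}$ if $k-1<i<l-1$; $\lambda_{k,l+1}\lambda_{k,l}$ if $i=l-1$; $\lambda_{k,l}$ if $i>l-1$; $s_i(\lambda_{l,k})=\lambda_{l+1,k+1}$ if $i<k-1$; $\lambda_{l+1,k+1}\lambda_{l+1,k}$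 if $i=k-1$; $\lambda_{l+1,k}$ if $k-1<i<l-1$; $\lambda_{l,k}\lambda_{l+1,k}$ if $i=l-1$; $\lambda_{l,k}$ if $i>l-1$. The subgroups $T_n\le VP_{n+1}$ are defined by $T_0=\{1\}$, $T_1=VP_2$, $T_{n+1}=\langle s_0(T_n),s_1(T_n),\ldots,s_n(T_n)\rangle$. For $1\le k\le n$ the elements $a_{k,n+1-k},b_{k,n+1-k}\in VP_{n+1}$ are $$a_{k,n+1-k}=s_{n-1}s_{n-2}\cdots s_{k}\hat{s}_{k-1}s_{k-2}\cdots s_0\lambda_{1,2},\qquad b_{k,n+1-k}=s_{n-1}s_{n-2}\cdots s_{k}\hat{s}_{k-1}s_{k-2}\cdots s_0\lambda_{2,1},$$ where the hat means that $s_{k-1}$ is omitted. *)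

(* Defs.v *)
From HB Require Import structures.
From mathcomp Require Import all_boot.
From mathcomp Require Import boolp classical_sets.
From mathcomp Require Import zify.

Set Implicit Arguments.
Unset Strict Implicit.
Unset Printing Implicit Defensive.

Import Algebra.
Local Open Scope group_scope.
Local Open Scope classical_set_scope.

Definition is_subgroup (G : groupType) (H : set G) : Prop :=
  H 1 /\ forall x y : G, H x -> H y -> H (x / y).

Definition gen_subgroup (G : groupType) (A : set G) : set G :=
  smallest (@is_subgroup G) A.

(** Words over [X] are sequences of letters [(x, e)], standing for [x] when
    [e = false] and for [x^-1] when [e = true].  The group presented by [X] and
    a set [R] of pairs of words is the quotient of words by the congruence
    generated by [R] and by free cancellation. *)
Section Presentation.
Variable X : choiceType.
Notation word := (seq (X * bool)).
Variable R : word -> word -> Prop.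

Inductive pres_cong : word -> word -> Prop :=
| PresRefl u : pres_cong u u
| PresSym u v : pres_cong u v -> pres_cong v u
| PresTrans v u w : pres_cong u v -> pres_cong v w -> pres_cong u w
| PresCancel u v x e : pres_cong (u ++ (x, e) :: (x, ~~ e) :: v) (u ++ v)
| PresRel u v l r : R l r -> pres_cong (u ++ l ++ v) (u ++ r ++ v).

Definition pres_congb (u v : word) : bool := `[< pres_cong u v >].

Lemma pres_congb_refl : reflexive pres_congb.
Proof. by move=> u; apply/asboolP/PresRefl. Qed.

Lemma pres_congb_sym : symmetric pres_congb.
Proof. by move=> u v; apply/asboolP/asboolP => /PresSym. Qed.

Lemma pres_congb_trans : transitive pres_congb.
Proof.
by move=> v u w /asboolP uv /asboolP vw; apply/asboolP/(PresTrans uv vw).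
Qed.

Canonical pres_cong_equiv :=
  EquivRel pres_congb pres_congb_refl pres_congb_sym pres_congb_trans.

Definition presented : Type := {eq_quot pres_congb}%qT.
HB.instance Definition _ := Choice.on presented.
HB.instance Definition _ := EqQuotient.on presented.

Definition pres_class (w : word) : presented := \pi_presented%qT w.

Lemma pres_classP u v : pres_class u = pres_class v <-> pres_cong u v.
Proof.
by split=> [/eqP|uv]; [|apply/eqP]; rewrite /pres_class eqmodE => *;
  apply/asboolP.
Qed.

Lemma pres_classK (x : presented) : pres_class (repr x) = x.
Proof. exact: reprK. Qed.

Lemma repr_pres_class u : pres_cong (repr (pres_class u)) u.
Proof. by apply/pres_classP; rewrite pres_classK. Qed.

Definition word_inv (w : word) : word := [seq (a.1, ~~ a.2) | a <- rev w].

Lemma pres_cong_ctx s t u v :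
  pres_cong u v -> pres_cong (s ++ u ++ t) (s ++ v ++ t).
Proof.
elim=> {u v} [u|u v _|v u w _ uv _ vw|u v x e|u v l r Rlr].
- exact: PresRefl.
- exact: PresSym.
- exact: PresTrans uv vw.
- by have := PresCancel (s ++ u) (v ++ t) x e; rewrite -!catA /= -?catA.
- by have := PresRel (s ++ u) (v ++ t) Rlr; rewrite -!catA.
Qed.

Lemma pres_cong_cat u u' v v' :
  pres_cong u u' -> pres_cong v v' -> pres_cong (u ++ v) (u' ++ v').
Proof.
move=> uu' vv'; apply: (@PresTrans (u' ++ v)).
  exact: (pres_cong_ctx [::] v uu').
by have := pres_cong_ctx u' [::] vv'; rewrite !cats0.
Qed.

Lemma word_invK : involutive word_inv.
Proof.
move=> w; rewrite /word_inv -map_rev revK -map_comp -[RHS]map_id.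
by apply: eq_map => -[x e] /=; rewrite negbK.
Qed.

Lemma word_mulwV w : pres_cong (w ++ word_inv w) [::].
Proof.
elim/last_ind: w => [|w [x e] IH]; first exact: PresRefl.
apply: PresTrans IH; rewrite /word_inv rev_rcons /= cat_rcons.
exact: PresCancel.
Qed.

Lemma word_mulVw w : pres_cong (word_inv w ++ w) [::].
Proof. by rewrite -{2}[w]word_invK; apply: word_mulwV. Qed.

Lemma word_inv_cong u v : pres_cong u v -> pres_cong (word_inv u) (word_inv v).
Proof.
move=> uv; apply: (@PresTrans (word_inv u ++ v ++ word_inv v)).
  by have := pres_cong_ctx (word_inv u) [::] (PresSym (word_mulwV v));
    rewrite !cats0.
have := pres_cong_ctx (word_inv u) (word_inv v) (PresSym uv).
move/PresTrans; apply.
by have := pres_cong_ctx [::] (word_inv v) (word_mulVw u); rewrite /= -catA.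
Qed.

Definition pres_one : presented := pres_class [::].
Definition pres_mul (x y : presented) := pres_class (repr x ++ repr y).
Definition pres_inv (x : presented) := pres_class (word_inv (repr x)).

Lemma pres_mulE u v :
  pres_mul (pres_class u) (pres_class v) = pres_class (u ++ v).
Proof. by apply/pres_classP/pres_cong_cat; apply: repr_pres_class. Qed.

Lemma pres_invE u : pres_inv (pres_class u) = pres_class (word_inv u).
Proof. by apply/pres_classP/word_inv_cong/repr_pres_class. Qed.

Lemma pres_mulA : associative pres_mul.
Proof.
move=> x y z; rewrite -[x]pres_classK -[y]pres_classK -[z]pres_classK.
by rewrite !pres_mulE catA.
Qed.

Lemma pres_mul1 : left_id pres_one pres_mul.
Proof. by move=> x; rewrite -[x]pres_classK pres_mulE. Qed.

Lemma pres_mulr1 : right_id pres_one pres_mul.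
Proof. by move=> x; rewrite -[x]pres_classK pres_mulE cats0. Qed.

Lemma pres_mulV : left_inverse pres_one pres_inv pres_mul.
Proof.
move=> x; rewrite -[x]pres_classK pres_invE pres_mulE.
exact/pres_classP/word_mulVw.
Qed.

Lemma pres_mulrV : right_inverse pres_one pres_inv pres_mul.
Proof.
move=> x; rewrite -[x]pres_classK pres_invE pres_mulE.
exact/pres_classP/word_mulwV.
Qed.

HB.instance Definition _ := isGroup.Build presented
  pres_mulA pres_mul1 pres_mulr1 pres_mulV pres_mulrV.

Lemma pres_class_cat u v :
  pres_class u * pres_class v = pres_class (u ++ v).
Proof. exact: pres_mulE. Qed.

Definition pres_gen (x : X) : presented := pres_class [:: (x, false)].

Lemma pres_gen3 x y z : pres_gen x * pres_gen y * pres_gen z =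
  pres_class [:: (x, false); (y, false); (z, false)].
Proof.
rewrite -[X in pres_class X]/(([:: (x, false)] ++ [:: (y, false)]) ++ _).
by rewrite -!pres_class_cat.
Qed.

Section Lift.
Variables (G : groupType) (f : X -> G).

Fixpoint word_eval (w : word) : G :=
  if w is (x, e) :: w' then (if e then (f x)^-1 else f x) * word_eval w' else 1.

Definition respects_relations : Prop :=
  forall l r, R l r -> word_eval l = word_eval r.

Lemma word_eval_cat u v : word_eval (u ++ v) = word_eval u * word_eval v.
Proof. by elim: u => [|[x e] u IH] /=; rewrite ?mul1g // IH mulgA. Qed.

Hypothesis fR : respects_relations.

Lemma word_eval_cong u v : pres_cong u v -> word_eval u = word_eval v.
Proof.
elim=> {u v} [//|u v _ -> //|v u w _ -> _ -> //|u v x e|u v l r Rlr].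
  by rewrite !word_eval_cat; congr (_ * _); case: e; rewrite /= ?mulKg ?mulVKg.
by rewrite !word_eval_cat (fR Rlr).
Qed.

Definition pres_lift of respects_relations : presented -> G :=
  fun x => word_eval (repr x).

Lemma pres_lift_class w : pres_lift fR (pres_class w) = word_eval w.
Proof. exact/word_eval_cong/repr_pres_class. Qed.

Lemma pres_lift_gen x : pres_lift fR (pres_gen x) = f x.
Proof. by rewrite pres_lift_class /= mulg1. Qed.

Lemma pres_liftM : {morph pres_lift fR : x y / x * y}.
Proof.
move=> x y; rewrite -[x]pres_classK -[y]pres_classK.
by rewrite pres_class_cat !pres_lift_class word_eval_cat.
Qed.

Lemma pres_lift1 : pres_lift fR 1 = 1.
Proof. exact: pres_lift_class [::]. Qed.

HB.instance Definition _ :=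
  isUMagmaMorphism.Build presented G (pres_lift fR) (pres_lift1, pres_liftM).

End Lift.
End Presentation.

Definition VPgen (n : nat) : choiceType :=
  {p : nat * nat | [&& 1 <= p.1 <= n, 1 <= p.2 <= n & p.1 != p.2]}.

Inductive VPrel (n : nat) : seq (VPgen n * bool) -> seq (VPgen n * bool) -> Prop :=
| VPcomm (g h : VPgen n) (i j k l : nat) :
    uniq [:: i; j; k; l] -> val g = (i, j) -> val h = (k, l) ->
    VPrel [:: (g, false); (h, false)] [:: (h, false); (g, false)]
| VPbraid (f g h : VPgen n) (i j k : nat) :
    uniq [:: i; j; k] ->
    val f = (k, i) -> val g = (k, j) -> val h = (i, j) ->
    VPrel [:: (f, false); (g, false); (h, false)]
          [:: (h, false); (g, false); (f, false)].

Definition VP (n : nat) : Type := presented (@VPrel n).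
HB.instance Definition _ n := Group.on (VP n).

(** [lam n i j] is the generator lambda_{ij} of VP_n, indices running from 1 to
    [n]; by convention it is 1 when [i = j] or an index is out of range. *)
Definition lam (n i j : nat) : VP n :=
  oapp (fun g : VPgen n => pres_gen (@VPrel n) g) 1 (insub (i, j)).

Lemma lam_gen n (g : VPgen n) :
  lam n (val g).1 (val g).2 = pres_gen (@VPrel n) g.
Proof. by rewrite /lam -surjective_pairing valK. Qed.

Lemma lam_comm n i j k l : uniq [:: i; j; k; l] ->
  lam n i j * lam n k l = lam n k l * lam n i j.
Proof.
move=> ijkl; rewrite /lam.
case: insubP => [g _ gE|_] /=; last by rewrite mul1g mulg1.
case: insubP => [h _ hE|_] /=; last by rewrite mul1g mulg1.
rewrite /pres_gen !pres_class_cat; apply/pres_classP.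
exact: (PresRel [::] [::] (VPcomm ijkl gE hE)).
Qed.

Lemma lam_out n i j :
  ~~ [&& 1 <= i <= n, 1 <= j <= n & i != j] -> lam n i j = 1.
Proof. by move=> ij; rewrite /lam insubF //=; apply/negbTE. Qed.

Lemma lam_braid n i j k : uniq [:: i; j; k] ->
  lam n k i * lam n k j * lam n i j = lam n i j * lam n k j * lam n k i.
Proof.
move=> ijk.
have [ir|ir] := boolP (1 <= i <= n); last first.
  by rewrite !(@lam_out n _ i, @lam_out n i) ?mul1g ?mulg1 //; lia.
have [jr|jr] := boolP (1 <= j <= n); last first.
  by rewrite !(@lam_out n _ j) ?mul1g ?mulg1 //; lia.
have [kr|kr] := boolP (1 <= k <= n); last first.
  by rewrite !(@lam_out n k) ?mul1g ?mulg1 //; lia.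
rewrite /lam.
have [ij [ki kj]] : i != j /\ k != i /\ k != j.
  by move: ijk; rewrite /= !inE; lia.
case: insubP => [f _ fE|]; last by rewrite /= ir kr ki.
case: insubP => [g _ gE|]; last by rewrite /= jr kr kj.
case: insubP => [h _ hE|]; last by rewrite /= ir jr ij.
rewrite /= !pres_gen3; apply/pres_classP.
exact: (PresRel [::] [::] (VPbraid ijk fE gE hE)).
Qed.

Lemma VP_respects n (G : groupType) (F : nat -> nat -> G) :
  (forall i j k l, uniq [:: i; j; k; l] ->
     all (fun x => 1 <= x <= n) [:: i; j; k; l] ->
     F i j * F k l = F k l * F i j) ->
  (forall i j k, uniq [:: i; j; k] ->
     all (fun x => 1 <= x <= n) [:: i; j; k] ->
     F k i * F k j * F i j = F i j * F k j * F k i) ->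
  respects_relations (@VPrel n) (fun g => F (val g).1 (val g).2).
Proof.
move=> Fc Fb l r [g h i j k l' ijkl gE hE|f g h i j k ijk fE gE hE] /=.
  rewrite !mulg1 gE hE /=; apply: Fc => //.
  by move: (valP g) (valP h); rewrite gE hE /=; lia.
rewrite !mulg1 !mulgA fE gE hE /=; apply: Fb => //.
by move: (valP f) (valP g) (valP h); rewrite fE gE hE /=; lia.
Qed.

Lemma VP_hom_ext n (G : groupType) (p q : {multiplicative VP n -> G}) :
  p 1 = 1 -> q 1 = 1 ->
  (forall i j, 1 <= i <= n -> 1 <= j <= n -> i != j ->
     p (lam n i j) = q (lam n i j)) -> p =1 q.
Proof.
move=> p1 q1 pq x; rewrite -[x]pres_classK; elim: (repr x) => [|[g e] w IH].
  by rewrite -[pres_class _ _]/(1 : VP n) p1 q1.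
rewrite -cat1s -pres_class_cat !gmulfM IH.
congr (_ * _).
have pqg : p (pres_gen (@VPrel n) g) = q (pres_gen (@VPrel n) g).
  by rewrite -lam_gen pq //; case/and3P: (valP g).
case: e => //.
have inv_class : (pres_gen (@VPrel n) g)^-1 = pres_class (@VPrel n) [:: (g, true)].
  exact: pres_invE.
rewrite -inv_class.
have hV (h : {multiplicative VP n -> G}) y : h 1 = 1 -> h y^-1 = (h y)^-1.
  move=> h1; apply: (mulgI (h y)); rewrite -gmulfM !mulgV //.
by rewrite !hV // pqg.
Qed.

(** For [m <= n], [incl n : VP m -> VP n] is the embedding sending lambda_{ij}
    to lambda_{ij}.  It is defined for all [m] and [n] to avoid transports along
    equalities of indices; when [m > n] it kills every generator with an index
    larger than [n]. *)
Definition incl_gen (m n : nat) (g : VPgen m) : VP n :=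
  lam n (val g).1 (val g).2.

Lemma incl_respects m n : respects_relations (@VPrel m) (@incl_gen m n).
Proof.
by apply: (@VP_respects m _ (lam n)) => [i j k l u _|i j k u _];
  [apply: lam_comm|apply: lam_braid].
Qed.

Definition incl {m : nat} (n : nat) : VP m -> VP n :=
  pres_lift (@incl_respects m n).
HB.instance Definition _ m n := UMagmaMorphism.on (@incl m n).

Lemma incl_lam m n i j : 1 <= i <= m -> 1 <= j <= m ->
  incl n (lam m i j) = lam n i j.
Proof.
move=> ir jr; have [->|ij] := eqVneq i j.
  by rewrite !lam_out ?gmulf1 // eqxx !andbF.
rewrite /lam; case: insubP => [g _ gE|]; last by rewrite /= ir jr ij.
by rewrite /= /incl pres_lift_gen /incl_gen gE.
Qed.

Lemma incl_id n (x : VP n) : incl n x = x.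
Proof.
apply: (@VP_hom_ext n _ (incl n) idfun) => // [|i j ir jr _].
  exact: gmulf1.
exact: incl_lam.
Qed.

Lemma incl_incl m n p (x : VP m) : (m <= n) || (p <= n) ->
  incl p (incl n x) = incl p x.
Proof.
move=> mnp.
apply: (@VP_hom_ext m _ (incl p \o incl n) (incl p)) => [||i j ir jr _].
- by rewrite /= !gmulf1.
- exact: gmulf1.
rewrite -[LHS]/(incl p (incl n (lam m i j))) -[RHS]/(incl p (lam m i j)).
rewrite (@incl_lam m n) // (@incl_lam m p) //.
have [/andP[ii jj]|ij] := boolP ((i <= n) && (j <= n)).
  by rewrite incl_lam //; lia.
by rewrite (@lam_out n) ?gmulf1 ?lam_out //; lia.
Qed.

Lemma incl_inj m n : m <= n -> injective (@incl m n).
Proof.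
move=> mn; apply: (can_inj (g := incl m)) => x.
by rewrite incl_incl ?mn // incl_id.
Qed.

(** The image of lambda_{kl} and of lambda_{lk} under s_i, for [k < l]. *)
Definition degen_up (n i k l : nat) : VP n.+1 :=
  if i < k.-1 then lam n.+1 k.+1 l.+1
  else if i == k.-1 then lam n.+1 k l.+1 * lam n.+1 k.+1 l.+1
  else if i < l.-1 then lam n.+1 k l.+1
  else if i == l.-1 then lam n.+1 k l.+1 * lam n.+1 k l
  else lam n.+1 k l.

Definition degen_down (n i k l : nat) : VP n.+1 :=
  if i < k.-1 then lam n.+1 l.+1 k.+1
  else if i == k.-1 then lam n.+1 l.+1 k.+1 * lam n.+1 l.+1 k
  else if i < l.-1 then lam n.+1 l.+1 k
  else if i == l.-1 then lam n.+1 l k * lam n.+1 l.+1 k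
  else lam n.+1 l k.

Definition degen_lam (n i : nat) (a b : nat) : VP n.+1 :=
  if a < b then degen_up n i a b else degen_down n i b a.

Definition degen_gen (n i : nat) (g : VPgen n) : VP n.+1 :=
  degen_lam n i (val g).1 (val g).2.

(** The position of strand [x <> c] after doubling strand [c]. *)
Definition shift (c x : nat) : nat := (c < x) + x.

Lemma degen_lamE n i a b : 0 < a -> 0 < b -> a != b ->
  let c := i.+1 in
  degen_lam n i a b =
    if a == c then lam n.+1 c (shift c b) * lam n.+1 c.+1 (shift c b)
    else if b == c then lam n.+1 (shift c a) c.+1 * lam n.+1 (shift c a) c
    else lam n.+1 (shift c a) (shift c b).
Proof.
move=> a0 b0 ab /=; rewrite /degen_lam /degen_up /degen_down /shift.
by repeat (case: ifP => ?); try lia; repeat f_equal; lia.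
Qed.

Section BraidDouble.
Variable G : groupType.

Lemma braid_double1 (x x' y y' p : G) :
  x' * y = y * x' -> x * y' = y' * x ->
  x * y * p = p * y * x -> x' * y' * p = p * y' * x' ->
  (x * x') * (y * y') * p = p * (y * y') * (x * x').
Proof.
move=> c1 c2 b1 b2.
rewrite -!mulgA [x' * _]mulgA c1 -!mulgA (mulgA x') b2 !mulgA b1 -!mulgA.
by rewrite (mulgA x) c2 -!mulgA.
Qed.

Lemma braid_double2 (x x' y p p' : G) :
  x * p = p * x -> x' * p' = p' * x' ->
  x' * y * p = p * y * x' -> x * y * p' = p' * y * x ->
  (x * x') * y * (p * p') = (p * p') * y * (x * x').
Proof.
move=> c1 c2 b1 b2.
have -> : x * x' * y * (p * p') = x * (x' * y * p) * p' by rewrite !mulgA.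
have -> : p * p' * y * (x * x') = p * (p' * y * x) * x' by rewrite !mulgA.
by rewrite b1 -b2 !mulgA c1 -!mulgA c2.
Qed.

Lemma braid_double3 (x y y' p p' : G) :
  y * p' = p' * y -> y' * p = p * y' ->
  x * y' * p' = p' * y' * x -> x * y * p = p * y * x ->
  x * (y' * y) * (p' * p) = (p' * p) * (y' * y) * x.
Proof.
move=> c1 c2 b1 b2.
have -> : x * (y' * y) * (p' * p) = x * y' * (y * p') * p by rewrite !mulgA.
have -> : p' * p * (y' * y) * x = p' * (p * y') * y * x by rewrite !mulgA.
rewrite c1 -c2 !mulgA b1.
by rewrite -!mulgA (mulgA x) b2 -!mulgA.
Qed.

End BraidDouble.

Lemma degen_respects n i : respects_relations (@VPrel n) (@degen_gen n i).
Proof.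
apply: (@VP_respects n _ (degen_lam n i)) => [a b k l u r|a b k u r].
  have [a0 [b0 [k0 l0]]] : 0 < a /\ 0 < b /\ 0 < k /\ 0 < l.
    by move: r => /=; lia.
  move: u; rewrite /= !inE => u.
  rewrite !degen_lamE //=; try lia.
  have cm x y z t : uniq [:: x; y; z; t] ->
      commute (lam n.+1 x y) (lam n.+1 z t) by exact: lam_comm.
  have side x y z t : x != y -> x != z -> x != t -> y != z -> y != t ->
    z != t -> uniq [:: x; y; z; t] by rewrite /= !inE; lia.
  rewrite -/(commute _ _).
  have cmM (x y z : VP n.+1) : commute x z -> commute y z -> commute (x * y) z.
    by move=> xz yz; apply: commute_sym; apply: commuteM; apply: commute_sym.
  do 4?[case: ifP => ?]; try (exfalso; lia);
    do ?[apply: commuteM | apply: cmM];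
    apply/cm/side; rewrite /shift; lia.
have [a0 [b0 k0]] : 0 < a /\ 0 < b /\ 0 < k by move: r => /=; lia.
move: u; rewrite /= !inE => u.
rewrite !degen_lamE //=; try lia.
have cm x y z t : x != y -> x != z -> x != t -> y != z -> y != t ->
    z != t -> lam n.+1 x y * lam n.+1 z t = lam n.+1 z t * lam n.+1 x y.
  by move=> *; apply: lam_comm; rewrite /= !inE; lia.
have br x y z : x != y -> x != z -> y != z ->
    lam n.+1 z x * lam n.+1 z y * lam n.+1 x y =
    lam n.+1 x y * lam n.+1 z y * lam n.+1 z x.
  by move=> *; apply: lam_braid; rewrite /= !inE; lia.
set c := i.+1.
have sc x : x != c -> shift c x != c /\ shift c x != c.+1.
  by rewrite /shift; lia.
have ss x y : x != y -> x != c -> y != c -> shift c x != shift c y.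
  by rewrite /shift; lia.
have [kc|kc] := eqVneq k c.
  have [ac bc] : a != c /\ b != c by lia.
  rewrite (negbTE ac) (negbTE bc).
  have := ss a b; have := sc a ac; have := sc b bc => ? ? ?.
  by apply: braid_double1; (apply: cm || apply: br); lia.
have [ac|ac] := eqVneq a c.
  have bc : b != c by lia.
  rewrite (negbTE bc).
  have := ss k b; have := sc k kc; have := sc b bc => ? ? ?.
  by apply: braid_double2; (apply: cm || apply: br); lia.
have [bc|bc] := eqVneq b c; last by apply: br; apply: ss; lia.
have := ss k a; have := sc k kc; have := sc a ac => ? ? ?.
by apply: braid_double3; (apply: cm || apply: br); lia.
Qed.

(** s_i : VP_n -> VP_{n+1}, doubling strand [i + 1]; meaningful for [i < n]. *)
Definition degen (n i : nat) : VP n -> VP n.+1 :=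
  pres_lift (@degen_respects n i).
Arguments degen {n} i.
HB.instance Definition _ n i := UMagmaMorphism.on (@degen n i).

Lemma degen_up_lam n i k l : 1 <= k -> k < l -> l <= n ->
  degen i (lam n k l) = degen_up n i k l.
Proof.
move=> k1 kl ln; rewrite /lam; case: insubP => [g _ gE|] /=; last by lia.
by rewrite /degen pres_lift_gen /degen_gen gE /degen_lam /= kl.
Qed.

Lemma degen_down_lam n i k l : 1 <= k -> k < l -> l <= n ->
  degen i (lam n l k) = degen_down n i k l.
Proof.
move=> k1 kl ln; rewrite /lam; case: insubP => [g _ gE|] /=; last by lia.
by rewrite /degen pres_lift_gen /degen_gen gE /degen_lam /= ltnNge ltnW.
Qed.

Fixpoint T (n : nat) : set (VP n.+1) :=
  match n with
  | 0 => [set 1]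
  | m.+1 =>
      if m is 0 then setT
      else gen_subgroup (\bigcup_(i < m.+1) (degen i @` @T m))
  end.
Arguments T n : clear implicits.

(** For [1 <= k <= m.+1], [degens k m : VP 2 -> VP m.+2] is the composite
    s_m ... s_k s_{k-2} ... s_0: its [j]-th factor, counted from 0 on the right,
    is s_j if [j < k-1] and s_{j+1} otherwise. *)
Fixpoint degens (k m : nat) : VP 2 -> VP m.+2 :=
  match m with
  | 0 => id
  | m'.+1 => fun x => degen (bump k.-1 m') (degens k m' x)
  end.

(** a_{k,l} and b_{k,l} for [k, l >= 1]; the type is then VP_{k+l}. *)
Definition elt_a (k l : nat) : VP (k + l).-2.+2 := degens k (k + l).-2 (lam 2 1 2).
Definition elt_b (k l : nat) : VP (k + l).-2.+2 := degens k (k + l).-2 (lam 2 2 1).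

(* Main.v *)
(** By the simplicial identity s_i s_j = s_{j+1} s_i (i <= j), s_i maps the
    cabling a_{k,l} to a_{k+1,l} or a_{k,l+1} (likewise for b), which by
    induction on n gives (1).  For (3), in VP_{n+1} the generators
    lambda_{k,n+1} with k < n are obtained from
    s_{n-1} lambda_{k,n} = lambda_{k,n+1} lambda_{k,n}, and lambda_{n,n+1} from
    s_{n-2} lambda_{n-1,n} = lambda_{n-1,n+1} lambda_{n,n+1}; the
    lambda_{n+1,k} are symmetric.  Then (2) follows by induction from (3): s_i
    maps the copy of T_m in VP_n into T_{m+1} when i <= m and fixes it when
    i > m. *)

Require Import Defs.
From mathcomp Require Import all_boot.
From mathcomp Require Import boolp classical_sets.
From mathcomp Require Import zify.

Set Implicit Arguments.
Unset Strict Implicit.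

Import Algebra.
Local Open Scope group_scope.
Local Open Scope classical_set_scope.

(** * Degeneracies on generators and the simplicial identity *)

Lemma degen_lam_inrange n i a b : 0 < a <= n -> 0 < b <= n -> a != b ->
  degen i (lam n a b) = degen_lam n i a b.
Proof.
move=> ar br ab; rewrite /degen_lam.
by case: ltnP => h; [apply: degen_up_lam | apply: degen_down_lam]; lia.
Qed.

Lemma degenE n i a b : 0 < a <= n -> 0 < b <= n -> a != b ->
  degen i (lam n a b) =
    if a == i.+1 then
      lam n.+1 i.+1 (shift i.+1 b) * lam n.+1 i.+2 (shift i.+1 b)
    else if b == i.+1 then
      lam n.+1 (shift i.+1 a) i.+2 * lam n.+1 (shift i.+1 a) i.+1
    else lam n.+1 (shift i.+1 a) (shift i.+1 b).
Proof. by move=> ar br ab; rewrite degen_lam_inrange // degen_lamE //; lia. Qed.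

Lemma degenM n i : {morph @degen n i : x y / x * y}.
Proof. exact: gmulfM. Qed.

Lemma mulg_swap_mid (G : groupType) (x y z t : G) : y * z = z * y ->
  x * y * z * t = x * z * y * t.
Proof. by move=> yz; rewrite -(mulgA x) yz !mulgA. Qed.

(** Both sides double strands i+1 and j+1, or triple strand i+1 when i = j. As both are
    homomorphisms, it is enough to compare them on each lambda_{ab}. *)
Lemma degen_simplicial n i j (x : VP n) : i <= j ->
  degen i (degen j x) = degen j.+1 (degen i x).
Proof.
move=> ij.
apply: (@VP_hom_ext n _ (degen i \o degen j) (degen j.+1 \o degen i))
  => [||a b ar br ab].
- by rewrite /= !gmulf1.
- by rewrite /= !gmulf1.
change (degen i (degen j (lam n a b)) = degen j.+1 (degen i (lam n a b))).
rewrite (degenE j) // (degenE i) //.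
do 4?[case: ifP => ?].
all: try (exfalso; lia).
(* [rewrite ?degenM] would spend minutes unfolding [lam]. *)
all: repeat match goal with
  |- context [degen ?k (?u * ?v)] => rewrite (degenM k u v) end.
all: rewrite !degenE.
all: try match goal with |- is_true _ => by rewrite /shift; lia end.
all: repeat match goal with |- context [if ?c then _ else _] =>
  first [have -> : c = false by rewrite /shift; lia
        |have -> : c = true by rewrite /shift; lia] end.
all: rewrite ?mulgA.
all: try by do ?congr (_ * _); congr lam; rewrite /shift; lia.
(* Remaining: the indices i.+1 and j.+1 are both doubled, and the two middle
   factors, which have no strand in common, come in opposite orders. *)
all: rewrite mulg_swap_mid; last by apply: lam_comm; rewrite /= !inE /shift; lia.
all: by do ?congr (_ * _); congr lam; rewrite /shift; lia.
Qed.

(** * Degeneracies and added trivial strands *)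

Lemma incl_degen m n i (x : VP m) : m <= i -> m <= n ->
  degen i (incl n x) = incl n.+1 x.
Proof.
move=> mi mn.
apply: (@VP_hom_ext m _ (degen i \o incl n) (incl n.+1)) => [||a b ar br ab].
- by rewrite /= !gmulf1.
- exact: gmulf1.
change (degen i (incl n (lam m a b)) = incl n.+1 (lam m a b)).
rewrite !incl_lam // degenE //; try lia.
by rewrite !ifF; try lia; congr lam; rewrite /shift; lia.
Qed.

Lemma inclM m n : {morph @incl m n : x y / x * y}.
Proof. exact: gmulfM. Qed.

Lemma degen_incl m n i (x : VP m) : m <= n ->
  degen i (incl n x) = incl n.+1 (degen i x).
Proof.
move=> mn.
apply: (@VP_hom_ext m _ (degen i \o incl n) (incl n.+1 \o degen i))
  => [||a b ar br ab].
- by rewrite /= !gmulf1.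
- by rewrite /= !gmulf1.
change (degen i (incl n (lam m a b)) = incl n.+1 (degen i (lam m a b))).
rewrite incl_lam // !degenE //; try lia.
case: eqP => ai; last case: eqP => bi; rewrite ?inclM !incl_lam //;
  by rewrite /shift; lia.
Qed.

(* For [m < k] no factor of [degens k m] is skipped: it is s_{m-1} ... s_0. *)
Lemma degens_stable k m (x : VP 2) : m < k -> degens k.+1 m x = degens k m x.
Proof.
elim: m => //= m IH mk; rewrite IH; last lia.
by congr (degen _ _); rewrite /bump; lia.
Qed.

(* [degens k m] doubles the first strand into [k] copies and the second into
   [m + 2 - k] copies; s_i adds a copy to the first bundle iff [i < k]. *)
Lemma degen_degens i k m (x : VP 2) : 0 < k <= m.+1 -> i < m.+2 ->
  degen i (degens k m x) = degens ((i < k) + k) m.+1 x.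
Proof.
elim: m i k => [|m IH] i k kr ir.
  have -> : k = 1%N by lia.
  by case: i ir => [|[|]].
have dl j p : p < j.-1 -> degens j p.+1 x = degen p (degens j p x).
  by move=> jp; congr (degen _ _); rewrite /bump; lia.
have dr j p : j.-1 <= p -> degens j p.+1 x = degen p.+1 (degens j p x).
  by move=> jp; congr (degen _ _); rewrite /bump jp.
have st p : degens p.+2 p x = degens p.+1 p x by apply: degens_stable.
(* Doubling the last strand, [i = m.+2], is by definition the next factor of the composite. *)
have [im|im] := ltnP i m.+2; last first.
  have -> : i = m.+2 by lia.
  by rewrite [in RHS]dr; [congr (degen _ (degens _ _ _)); lia|lia].
(* Here the second bundle is a single strand: the composite is s_m ... s_0, with nothing skipped
   yet. *)
have [->|km] := eqVneq k m.+2.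
  rewrite im (dl m.+3) // st.
  have [im'|im'] := ltnP i m.+1; last by have -> : i = m.+1 by lia.
  rewrite [in LHS]dl // st degen_simplicial; last lia.
  by rewrite IH ?im' ?leqnn.
have {}kr : 0 < k <= m.+1 by lia.
(* Otherwise the outermost factor is s_{m+1}; moving s_i inside turns it into s_{m+2}. *)
rewrite (dr k); last lia.
rewrite degen_simplicial; last lia.
by rewrite IH // (dr _ m.+1) //; lia.
Qed.

(** * Generated subgroups *)

Lemma gen_subgroupP (G : groupType) (A : set G) : is_subgroup (gen_subgroup A).
Proof.
split=> [H [[H1 _] _] //|x y Ax Ay H HA].
by apply: HA.1.2; [apply: Ax|apply: Ay].
Qed.

Lemma gen_subgroup_min (G : groupType) (A H : set G) :
  is_subgroup H -> A `<=` H -> gen_subgroup A `<=` H.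
Proof. exact: smallest_sub. Qed.

Lemma gen_subgroup_incl (G : groupType) (A : set G) : A `<=` gen_subgroup A.
Proof. exact: sub_gen_smallest. Qed.

Lemma subgroupV (G : groupType) (H : set G) x :
  is_subgroup H -> H x -> H x^-1.
Proof. by move=> [H1 HF] Hx; rewrite -[x^-1]mul1g; apply: HF. Qed.

Lemma subgroupM (G : groupType) (H : set G) x y :
  is_subgroup H -> H x -> H y -> H (x * y).
Proof.
by move=> sH Hx Hy; rewrite -[y]invgK; apply: sH.2 => //; apply: subgroupV.
Qed.

Lemma subgroup_cancell (G : groupType) (H : set G) x y :
  is_subgroup H -> H x -> H (x * y) -> H y.
Proof.
by move=> sH Hx Hxy; rewrite -[y](mulKg x); apply: subgroupM => //; apply: subgroupV.
Qed.

Lemma subgroup_cancelr (G : groupType) (H : set G) x y :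
  is_subgroup H -> H y -> H (x * y) -> H x.
Proof. by move=> sH Hy Hxy; rewrite -[x](mulgK y); apply: sH.2. Qed.

Lemma gen_subgroup_hom (G K : groupType) (f : UMagmaMorphism.type G K)
  (A : set G) (H : set K) : is_subgroup H -> (forall x, A x -> H (f x)) ->
  forall x, gen_subgroup A x -> H (f x).
Proof.
move=> [H1 HF] AH; apply: (@gen_subgroup_min _ A (f @^-1` H)) => //.
by split=> [|x y Hx Hy]; rewrite /preimage /= ?gmulf1 // gmulfF; apply: HF.
Qed.

Lemma VP_gen_lam n (H : set (VP n)) : is_subgroup H ->
  (forall a b, 0 < a <= n -> 0 < b <= n -> a != b -> H (lam n a b)) ->
  H = setT.
Proof.
move=> sH Hlam; apply/seteqP; split=> // x _.
rewrite -[x]pres_classK; elim: (repr x) => [|[g e] w IH]; first exact: sH.1.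
rewrite -cat1s -pres_class_cat; apply: subgroupM => //.
have Hg : H (pres_gen (@VPrel n) g).
  by rewrite -lam_gen; case/and3P: (valP g) => *; apply: Hlam.
case: e => //.
rewrite -[pres_class _ _]/(pres_class _ (word_inv [:: (g, false)])) -pres_invE.
exact: (subgroupV sH Hg).
Qed.

(** * Generators of T_n *)

(** These are the a_{k,l} and b_{k,l} with k + l = m + 2, typed directly in [VP m.+2] so that
    induction on [m] needs no cast. *)
Definition cablings m : set (VP m.+2) :=
  [set x | exists k : nat, (0 < k <= m.+1)%N /\
     (x = degens k m (lam 2 1 2) \/ x = degens k m (lam 2 2 1))].
Arguments cablings : clear implicits.

Lemma T_gen_degens m : T m.+1 = gen_subgroup (cablings m).
Proof.
elim: m => [|m IH].
  apply/esym/VP_gen_lam; first exact: gen_subgroupP.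
  move=> a b ar br ab; apply: gen_subgroup_incl; exists 1%N; split=> //=.
  have [[-> ->]|[-> ->]] : (a = 1%N /\ b = 2) \/ (a = 2 /\ b = 1%N) by lia.
    by left.
  by right.
rewrite [LHS]/(gen_subgroup (\bigcup_(i < m.+2) (degen i @` @T m.+1))) IH.
apply/seteqP; split; apply: gen_subgroup_min; try exact: gen_subgroupP.
  move=> _ [i /= im [x + <-]]; move: x.
  apply: (gen_subgroup_hom (f := degen i)) => [|x [k [kr xE]]].
    exact: gen_subgroupP.
  apply: gen_subgroup_incl; change (cablings m.+1 (degen i x)).
  exists ((i < k) + k)%N; split; first lia.
  by case: xE => ->; rewrite degen_degens //; [left|right].
move=> x [k [kr xE]]; apply: gen_subgroup_incl.
(* s_0 lengthens the first bundle and so reaches every k > 1; k = 1 must come from s_1, which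
   lengthens the second. *)
have [i [k' [im k'r kE]]] : exists i k',
    [/\ i < m.+2, 0 < k' <= m.+1 & k = ((i < k') + k')%N].
  have [->|k1] := eqVneq k 1%N; first by exists 1%N, 1%N; split; lia.
  by exists 0, k.-1; split; lia.
exists i => //.
have [y [xy yE]] : exists y, x = degen i y /\ cablings m y.
  by case: xE => ->; eexists; (split; first by rewrite kE -degen_degens);
    exists k'; split=> //; [left|right].
by exists y => //; apply: gen_subgroup_incl.
Qed.

(** * Generation of the whole virtual pure braid group *)

Lemma VP_gen_degen n : 1 < n ->
  gen_subgroup (range (@incl n n.+1)
                   `|` \bigcup_(i < n) range (@degen n i)) =
       [set: VP n.+1].
Proof.
move=> n1; set A := (X in gen_subgroup X).
have sA := gen_subgroupP A.
have Ai (x : VP n) : gen_subgroup A (incl n.+1 x).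
  by apply: gen_subgroup_incl; left; exists x.
have Ad i (x : VP n) : i < n -> gen_subgroup A (degen i x).
  by move=> ilt; apply: gen_subgroup_incl; right; exists i => //; exists x.
have Al a b : a <= n -> b <= n -> gen_subgroup A (lam n.+1 a b).
  move=> an bn; have [r|r] := boolP [&& 0 < a, 0 < b & a != b].
    by rewrite -(@incl_lam n) //; lia.
  by rewrite lam_out; [exact: sA.1 | lia].
have Aup a : 0 < a < n -> gen_subgroup A (lam n.+1 a n.+1).
  move=> ar; have := Ad n.-1 (lam n a n).
  rewrite degen_up_lam /degen_up 1?ifF 1?ifF 1?ifF 1?ifT; try lia.
  by move=> H; apply: (subgroup_cancelr sA (Al a n _ _) (H _)); lia.
have Adown a : 0 < a < n -> gen_subgroup A (lam n.+1 n.+1 a).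
  move=> ar; have := Ad n.-1 (lam n n a).
  rewrite degen_down_lam /degen_down 1?ifF 1?ifF 1?ifF 1?ifT; try lia.
  by move=> H; apply: (subgroup_cancell sA (Al n a _ _) (H _)); lia.
(* Doubling strand n never yields lambda_{n,n+1}, so strand n-1 is doubled instead; the other factor
   lambda_{n-1,n+1} is already available. *)
have Aup_n : gen_subgroup A (lam n.+1 n n.+1).
  have := Ad n.-2 (lam n n.-1 n).
  rewrite degen_up_lam /degen_up 1?ifF 1?ifT ?prednK; try lia.
  by move=> H; apply: (subgroup_cancell sA (Aup n.-1 _) (H _)); lia.
have Adown_n : gen_subgroup A (lam n.+1 n.+1 n).
  have := Ad n.-2 (lam n n n.-1).
  rewrite degen_down_lam /degen_down 1?ifF 1?ifT ?prednK; try lia.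
  by move=> H; apply: (subgroup_cancelr sA (Adown n.-1 _) (H _)); lia.
apply: VP_gen_lam => // a b ar br ab.
have [aE|an] := eqVneq a n.+1.
  have [->|bn] := eqVneq b n; first by rewrite aE.
  by rewrite aE; apply: Adown; lia.
have [bE|bn] := eqVneq b n.+1; last by apply: Al; lia.
have [->|{}an] := eqVneq a n; first by rewrite bE.
by rewrite bE; apply: Aup; lia.
Qed.

Lemma VP_gen_T n : 1 < n ->
  gen_subgroup (\bigcup_(m in [set m | 1 <= m <= n.-1]) (incl n @` @T m)) =
    [set: VP n].
Proof.
elim: n => // n IH n1.
have [->|n2] := eqVneq n 1%N.
  apply/seteqP; split=> // x _; apply: gen_subgroup_incl.
  by exists 1%N => //; exists x => //; apply: incl_id.
set A := (X in gen_subgroup X).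
have sA := gen_subgroupP A.
have nn : 1 < n by lia.
apply/seteqP; split=> // x _.
have : [set: VP n.+1] x by [].
rewrite -VP_gen_degen //; move: x.
apply: gen_subgroup_min => // t [[y _ <-]|[i /= ilt [y _ <-]]].
  have : [set: VP n] y by [].
  rewrite -(IH nn); move: y.
  apply: (gen_subgroup_hom (f := incl n.+1)) => // s [m /= mr [z Tz <-]].
  apply: gen_subgroup_incl; exists m => /=; first lia.
  by exists z => //; rewrite incl_incl //; lia.
have : [set: VP n] y by [].
rewrite -(IH nn); move: y.
apply: (gen_subgroup_hom (f := degen i)) => // s [m /= mr [z Tz <-]].
apply: gen_subgroup_incl.
have [im|im] := ltnP i m.+1.
  exists m.+1 => /=; first lia.
  exists (degen i z); last by rewrite degen_incl //; lia.
  (* [T m.+1] unfolds to a subgroup generated by degeneracies only for m > 0, which [mr] ensures. *)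
  case: m mr z Tz im => // m mr z Tz im.
  by apply: gen_subgroup_incl; exists i => //; exists z.
exists m => /=; first lia.
by exists z => //; rewrite incl_degen //; lia.
Qed.

(** The inclusions here are mere casts: k + l = n + 1 makes each of them the identity. *)
Lemma T_gen_elt n : 0 < n -> T n = gen_subgroup
             [set x : VP n.+1 | exists k l : nat,
                [/\ 1 <= k, 1 <= l, k + l = n.+1 &
                    x = incl n.+1 (elt_a k l) \/ x = incl n.+1 (elt_b k l)]].
Proof.
case: n => // m _; rewrite T_gen_degens; congr gen_subgroup; apply/seteqP.
have inclE k l y : k + l = m.+2 ->
    incl m.+2 (degens k (k + l).-2 y) = degens k m y.
  by move=> ->; apply: incl_id.
split=> x.
  move=> [k [kr xE]]; exists k, (m.+2 - k); split; try lia.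
  by rewrite !inclE //; lia.
move=> [k [l [k1 l1 kl]]]; rewrite !inclE // => xE.
by exists k; split=> //; lia.
Qed.

Theorem proposition3p2 :
  (forall n : nat, 3 <= n.+1 ->
     T n = gen_subgroup
             [set x : VP n.+1 | exists k l : nat,
                [/\ 1 <= k, 1 <= l, k + l = n.+1 &
                    x = incl n.+1 (elt_a k l) \/ x = incl n.+1 (elt_b k l)]]) /\
  (forall n : nat, 2 <= n ->
     gen_subgroup (\bigcup_(m in [set m | 1 <= m <= n.-1]) (incl n @` T m)) =
       [set: VP n] /\
     gen_subgroup
       [set x : VP n | exists k l : nat,
          [/\ 1 <= k <= n.-1, 1 <= l <= n.-1, 2 <= k + l <= n &
              x = incl n (elt_a k l) \/ x = incl n (elt_b k l)]] =
       [set: VP n]) /\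
  (forall n : nat, 2 <= n ->
     gen_subgroup (range (@incl n n.+1)
                   `|` \bigcup_(i < n) range (@degen n i)) =
       [set: VP n.+1]).
Proof.
split; first by move=> n n2; apply: T_gen_elt; lia.
split=> [n n2|]; last exact: VP_gen_degen.
split; first exact: VP_gen_T.
apply/seteqP; split=> // x _.
have : [set: VP n] x by [].
rewrite -VP_gen_T //; move: x.
apply: gen_subgroup_min => [|t [m /= mr [z Tz <-]]]; first exact: gen_subgroupP.
(* The case m = 1 occurs too: there a_{1,1} and b_{1,1} are the two generators of VP_2. *)
move: z Tz; rewrite T_gen_elt; last lia.
apply: (gen_subgroup_hom (f := incl n)) => [|s [k [l [k1 l1 kl xE]]]].
  exact: gen_subgroupP.
apply: gen_subgroup_incl; exists k, l; split; try lia.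
by case: xE => ->; [left|right]; apply: incl_incl; lia.
Qed.
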